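(* Let $d\in\mathbb{N}$ and $\eta\in\mathbb{R}$ with $\eta\le 1/d$. Then $\lambda(\mathcal{D}(\eta))=\infty$ and $\lambda(\mathcal{D}(\eta)^c)=0$, where $\lambda$ is Lebesgue measure on $\mathbb{R}^d$.
   Context: For $\boldsymbol{\alpha}\in\mathbb{R}^d$ and $\eta\in\mathbb{R}$, the set of $\eta$-normalized approximations to $\boldsymbol{\alpha}$ is $\mathrm{NA}_\eta(\boldsymbol{\alpha})=\{|q|^{\eta}(q\boldsymbol{\alpha}-\boldsymbol{p}):q\in\mathbb{Z}\setminus\{0\},\ \boldsymbol{p}\in\mathbb{Z}^d\}$, and $\mathcal{A}_\eta(\boldsymbol{\alpha})$ denotes the set of all accumulation points of $\mathrm{NA}_\eta(\boldsymbol{\alpha})$ in $\mathbb{R}^d$. Define $\mathcal{D}(\eta)=\{\boldsymbol{\alpha}\in\mathbb{R}^d:\mathcal{A}_\eta(\boldsymbol{\alpha})=\mathbb{R}^d\}$, and $\mathcal{D}(\eta)^c=\mathbb{R}^d\setminus\mathcal{D}(\eta)$. *)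

(* Defs.v *)
From HB Require Import structures.
From mathcomp Require Import all_boot all_order all_algebra.
From mathcomp Require Import all_classical all_reals all_analysis.
Set Implicit Arguments. Unset Strict Implicit. Unset Printing Implicit Defensive.
Import Order.TTheory GRing.Theory Num.Theory.
Local Open Scope classical_set_scope.
Local Open Scope ring_scope.

(* R^d is modelled as d.-tuple R, with MathComp-Analysis' product (tuple)
   sigma-algebra over the Borel sets of R, i.e. the Borel sets of R^d. *)

Definition NA (R : realType) (d : nat) (eta : R) (alpha : d.-tuple R)
  : set (d.-tuple R) :=
  [set v | exists (q : int) (p : d.-tuple int), q != 0 /\
     forall i : 'I_d, tnth v i =
       ((`|q|%:~R : R) `^ eta) * (q%:~R * tnth alpha i - (tnth p i)%:~R)].

Definition accum (R : realType) (d : nat) (A : set (d.-tuple R))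
  : set (d.-tuple R) :=
  [set x | forall e : R, 0 < e ->
     exists y, A y /\ y <> x /\ forall i : 'I_d, `|tnth y i - tnth x i| < e].

Definition Acc (R : realType) (d : nat) (eta : R) (alpha : d.-tuple R) :=
  accum (NA eta alpha).

Definition D (R : realType) (d : nat) (eta : R) : set (d.-tuple R) :=
  [set alpha | Acc eta alpha = setT].

Definition is_lebesgue_measure (R : realType) (d : nat)
  (lam : set (d.-tuple R) -> \bar R) : Prop :=
  forall a b : d.-tuple R, (forall i : 'I_d, tnth a i <= tnth b i) ->
    lam [set x | forall i : 'I_d, tnth a i <= tnth x i < tnth b i]
    = ((\prod_(i < d) (tnth b i - tnth a i)) : R)%:E.

(* Main.v *)
(** For eta < 0 the approximations qα - p, rescaled by |q|^eta, already form a
    fine grid when |q| is large, so every α lies in D(eta).  For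
    0 <= eta <= 1/d, fix a target y and e > 0 and let O be the set of α having
    an approximation within e of y.  By Dirichlet's theorem every α satisfies
    |qα - p| <= q^(-1/d) <= q^(-eta) for arbitrarily large q; with
    r = q^(-1-eta) the ball of radius re around p/q + ry is contained in O and
    its distance to α is at most a constant times its radius.  Hence the
    complement of O is porous at every point and at arbitrarily small scales,
    which forces it to be null.  D(eta) is the intersection of countably many
    such O. *)
Require Import Defs.
From HB Require Import structures.
From mathcomp Require Import all_boot all_order all_algebra.
From mathcomp Require Import all_classical all_reals all_analysis.
From mathcomp Require Import measurable_realfun ring lra.
Set Implicit Arguments. Unset Strict Implicit. Unset Printing Implicit Defensive.
Import Order.TTheory GRing.Theory Num.Theory.
Local Open Scope classical_set_scope.
Local Open Scope ring_scope.

(** * Measures of unions over a countable index type *)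

(** Subadditivity bounds the union of the [C i] and additivity computes that of the disjoint [A i];
    [pickle] moves both to [nat]. It serves to compare a cover with a disjoint family. *)
Lemma bigcup_measure_le (disp : measure_display) (T : measurableType disp)
    (R : realType) (mu : {measure set T -> \bar R}) (I : countType) (X : set I)
    (A C : I -> set T) (M : R) :
  (forall i, measurable (A i)) -> (forall i, measurable (C i)) ->
  trivIset X A -> 0 <= M -> (forall i, mu (C i) <= M%:E * mu (A i))%E ->
  (mu (\bigcup_(i in X) C i) <= M%:E * mu (\bigcup_(i in X) A i))%E.
Proof.
move=> mA mC tA M0 AC.
pose N := [set n | exists2 i, X i & pickle i = n].
pose ex (B : I -> set T) n := if unpickle n is Some i then B i else set0.
have exE B : \bigcup_(n in N) ex B n = \bigcup_(i in X) B i.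
  apply/seteqP; split=> [x [_ [i Xi <-]]|x [i Xi Bx]].
    by rewrite /ex pickleK => Bx; exists i.
  by exists (pickle i); [exists i|rewrite /ex pickleK].
have mex B : (forall i, measurable (B i)) -> forall n, measurable (ex B n).
  by move=> mB n; rewrite /ex; case: unpickle.
rewrite -!exE [in leRHS]measure_bigcup; last 2 first.
- by move=> n _; exact: mex.
- move=> _ _ [i Xi <-] [j Xj <-]; rewrite /ex !pickleK => ij.
  by rewrite (tA i j).
rewrite -nneseriesZl; last by move=> n _; exact: measure_ge0.
rewrite [in leLHS]bigcup_mkcond [in leRHS]eseries_mkcond.
have mexN n : measurable (if n \in N then ex C n else set0).
  by case: ifP => // _; exact: mex.
apply: le_trans.
  apply: measure_sigma_subadditive; [exact: mexN| |exact: subset_refl].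
  by apply: bigcup_measurable => n _; exact: mexN.
apply: lee_nneseries => [n _ _|n _]; first exact: measure_ge0.
case: ifP => _; last by rewrite measure0.
by rewrite /ex; case: unpickle => [i|]; rewrite ?AC// !measure0 mule0.
Qed.

Lemma measurable_bigcup_count (disp : measure_display) (T : measurableType disp)
    (I : countType) (X : set I) (A : I -> set T) :
  (forall i, X i -> measurable (A i)) -> measurable (\bigcup_(i in X) A i).
Proof.
move=> mA; rewrite bigcup_mkcond; apply: countable_bigcupT_measurable => // i.
by case: ifPn => // /set_mem /mA.
Qed.

Lemma bigcup_measure0 (disp : measure_display) (T : measurableType disp)
    (R : realType) (mu : {measure set T -> \bar R}) (I : countType) (X : set I)
    (C : I -> set T) :
  (forall i, measurable (C i)) -> (forall i, mu (C i) = 0%E) ->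
  mu (\bigcup_(i in X) C i) = 0%E.
Proof.
move=> mC C0; apply/eqP; rewrite -measure_le0.
have -> : 0%E = (0%:E * mu (\bigcup_(i in X) set0))%E by rewrite mul0e.
apply: bigcup_measure_le => // [i j _ _ [x []]//|i].
by rewrite C0 mul0e.
Qed.

Lemma ex_pow2_ge (R : realType) (t : R) : exists n : nat, t <= 2 ^+ n.
Proof.
exists (Num.bound `|t|); apply: (le_trans (ler_norm _)).
apply: (le_trans (ltW (archi_boundP (normr_ge0 _)))).
by rewrite -natrX ler_nat ltnW// ltn_expl.
Qed.

(** * Half-open dyadic cubes *)

Section Dyadic.
Context (R : realType) (d : nat).
Implicit Types (x y z : d.-tuple R) (k : {ffun 'I_d -> int}) (g : nat).

Definition cube (c : 'I_d -> R) (s : R) : set (d.-tuple R) :=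
  [set x | forall i, c i <= tnth x i < c i + s].

Definition dyadic_idx g x : {ffun 'I_d -> int} :=
  [ffun i => Num.floor (2 ^+ g * tnth x i)].

(** As fibres of [dyadic_idx], the cubes of one generation are disjoint and cover the space by
    definition; [dyadicE] recovers the geometry. *)
Definition dyadic g k : set (d.-tuple R) := [set x | dyadic_idx g x = k].

Lemma measurable_box (I : 'I_d -> set R) : (forall i, measurable (I i)) ->
  measurable [set x : d.-tuple R | forall i, I i (tnth x i)].
Proof.
move=> mI.
have -> : [set x : d.-tuple R | forall i, I i (tnth x i)] =
    \big[setI/setT]_(i < d) ((fun x : d.-tuple R => tnth x i) @^-1` (I i)).
  rewrite -bigcap_seq; apply/seteqP; split=> x /= Ix i.
    by move=> _; exact: Ix.
  by apply: (Ix i); rewrite /= mem_index_enum.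
apply: bigsetI_measurable => i _.
rewrite -[X in measurable X]setTI.
exact: measurable_tnth.
Qed.

Lemma measurable_cube c s : measurable (cube c s).
Proof.
apply: (@measurable_box (fun i => [set t | c i <= t < c i + s])) => i.
have -> : [set t | c i <= t < c i + s] = `[c i, c i + s[%classic.
  by apply/seteqP; split=> t /=; rewrite in_itv.
exact: measurable_itv.
Qed.


Lemma dyadicE g k : dyadic g k = cube (fun i => (k i)%:~R / 2 ^+ g) (2 ^+ g)^-1.
Proof.
have g0 : (0 : R) < 2 ^+ g by exact: exprn_gt0.
have cellP i (t : R) : ((k i)%:~R / 2 ^+ g <= t < (k i)%:~R / 2 ^+ g + (2 ^+ g)^-1)
    = (Num.floor (2 ^+ g * t) == k i).
  rewrite -{3}(mul1r (_^-1)) -mulrDl ler_pdivrMr// ltr_pdivlMr// floor_eq.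
  by rewrite rmorphD/= mulrC.
apply/seteqP; split=> x /=.
  by move=> xk i /=; rewrite cellP -xk ffunE.
by move=> kx; apply/ffunP => i; rewrite ffunE; apply/eqP; rewrite -cellP; exact: kx.
Qed.

Lemma measurable_dyadic g k : measurable (dyadic g k).
Proof. by rewrite dyadicE; exact: measurable_cube. Qed.

(** For an integer [m], [m <= v] iff [m * n <= n * v], so the floor of [n * v] determines that of
    [v]. This yields the nesting of dyadic cubes. *)
Lemma floor_natmul_inj (n : nat) (t u : R) : (0 < n)%N ->
  Num.floor (n%:R * t) = Num.floor (n%:R * u) -> Num.floor t = Num.floor u.
Proof.
move=> n0 tu; have n0R : (0 : R) < n%:R by rewrite ltr0n.
have shift (m : int) (v : R) : (m <= Num.floor v) = (m * n%:Z <= Num.floor (n%:R * v)).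
  by rewrite !floor_ge_int rmorphM/= mulrC ler_pM2l.
by apply/eqP; rewrite eq_le shift -tu -shift lexx shift tu -shift lexx.
Qed.

Lemma dyadic_idx_le g g' x y : (g <= g')%N ->
  dyadic_idx g' x = dyadic_idx g' y -> dyadic_idx g x = dyadic_idx g y.
Proof.
move=> gg' /ffunP xy; apply/ffunP => i; have := xy i; rewrite !ffunE.
rewrite -(subnK gg') exprD -!mulrA -natrX; apply: floor_natmul_inj.
by rewrite expn_gt0.
Qed.

Lemma dyadic_dist g x y : dyadic_idx g x = dyadic_idx g y ->
  forall i, `|tnth x i - tnth y i| < (2 ^+ g)^-1.
Proof.
move=> xy i; have : dyadic g (dyadic_idx g y) x by [].
have : dyadic g (dyadic_idx g y) y by [].
rewrite dyadicE => /(_ i) /andP[y1 y2] /(_ i) /andP[x1 x2].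
by rewrite ltr_distl; apply/andP; split; lra.
Qed.

End Dyadic.

Lemma lebesgue_cube (R : realType) (d : nat)
    (lam : {measure set (d.-tuple R) -> \bar R}) (c : 'I_d -> R) (s : R) :
  is_lebesgue_measure lam -> 0 <= s -> lam (cube c s) = (s ^+ d)%:E.
Proof.
move=> lebl s0.
have := lebl [tuple c i | i < d] [tuple c i + s | i < d].
under eq_bigr do rewrite !tnth_mktuple addrAC subrr add0r.
rewrite prodr_const card_ord => <-.
  by congr (lam _); apply/seteqP; split=> x /= cx i; have := cx i;
    rewrite !tnth_mktuple.
by move=> i; rewrite !tnth_mktuple lerDl.
Qed.

(** * Porous sets have measure zero *)

Section Porous.
Context (R : realType) (d : nat) (lam : {measure set (d.-tuple R) -> \bar R}).
Hypothesis lebl : is_lebesgue_measure lam.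
Context (O : set (d.-tuple R)) (K : R).
Hypothesis K0 : 0 <= K.
Hypothesis porous : forall (x : d.-tuple R) (g0 : nat),
  exists (g : nat) (z : d.-tuple R), [/\ (g0 <= g)%N,
    dyadic g (dyadic_idx g z) `<=` O &
    forall i, `|tnth x i - tnth z i| <= K / 2 ^+ g].

(* Generation-G approximation from outside of the complement of O in the unit
   cube k0. *)
Let F k0 G : set (d.-tuple R) := [set x | dyadic_idx 0 x = k0 /\
  ~ (dyadic G (dyadic_idx G x) `<=` O)].

Let F_dyadic k0 G x y : dyadic_idx G x = dyadic_idx G y -> F k0 G x -> F k0 G y.
Proof.
by move=> xy [x0 Fx]; split; rewrite -?xy// -(dyadic_idx_le (leq0n _) xy).
Qed.

Let F_bigcup k0 G : F k0 G = \bigcup_(k in dyadic_idx G @` F k0 G) dyadic G k.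
Proof.
apply/seteqP; split=> x; first by move=> Fx; exists (dyadic_idx G x) => //; exists x.
by case=> _ [y Fy <-] /esym; move/F_dyadic; apply.
Qed.

Let measurable_F k0 G : measurable (F k0 G).
Proof.
rewrite F_bigcup; apply: measurable_bigcup_count => k _.
exact: measurable_dyadic.
Qed.

Let F_sub k0 G G' : (G <= G')%N -> F k0 G' `<=` F k0 G.
Proof.
move=> GG' x [x0 Fx]; split=> // GO; apply: Fx => y xy; apply: GO.
exact: dyadic_idx_le xy.
Qed.

Let M : R := 2 ^+ d * (2 * K + 3) ^+ d.

(* Near every x there is a dyadic cube inside O;
   the maximal ones are pairwise disjoint, contained in F G minus the limit set,
   and their dilations by 2K+3 cover the part of F G away from the boundaries of
   its cubes (the concentric half cubes [cen]), which has proportion 2^-d. *)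
Let F_le k0 G : (lam (F k0 G) <= M%:E * lam (F k0 G `\` \bigcap_n F k0 n))%E.
Proof.
pose cen (k : {ffun 'I_d -> int}) : set (d.-tuple R) :=
  cube (fun i => (k i)%:~R / 2 ^+ G + 1 / 4 / 2 ^+ G) (1 / 2 / 2 ^+ G).
pose dy (gk : nat * {ffun 'I_d -> int}) : set (d.-tuple R) := dyadic gk.1 gk.2.
(* Contains all points within [K] sides of the dyadic cube, with one spare side at each end. *)
pose big (gk : nat * {ffun 'I_d -> int}) : set (d.-tuple R) :=
  cube (fun i => (gk.2 i)%:~R / 2 ^+ gk.1 - (K + 1) / 2 ^+ gk.1)
       ((2 * K + 3) / 2 ^+ gk.1).
(* Stopping rule: for [z] in [F k0 G], select the coarsest cube around [z] inside [O]. *)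
pose Y := [set gk | exists z, [/\ dyadic_idx gk.1 z = gk.2, F k0 G z,
  dyadic gk.1 gk.2 `<=` O &
  forall g', (g' < gk.1)%N -> ~ (dyadic g' (dyadic_idx g' z) `<=` O)]].
have pow_gt0 g : (0 : R) < (2 ^+ g)^-1 by rewrite invr_gt0 exprn_gt0.
have cen_dyadic k : cen k `<=` dyadic G k.
  move=> x; rewrite dyadicE => cx i.
  have /andP[] := cx i; have := pow_gt0 G; set h := (2 ^+ G)^-1 => h0 c1 c2.
  by apply/andP; split; lra.
have mdy gk : measurable (dy gk) by exact: measurable_dyadic.
have step1 : (lam (F k0 G) <=
    (2 ^+ d)%:E * lam (\bigcup_(k in dyadic_idx G @` F k0 G) cen k))%E.
  rewrite [in leLHS]F_bigcup; apply: bigcup_measure_le.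
  - by move=> k; exact: measurable_cube.
  - by move=> k; exact: measurable_dyadic.
  - move=> k k' _ _ [x [/cen_dyadic xk /cen_dyadic xk']].
    by rewrite -xk -xk'.
  - by rewrite exprn_ge0.
  - move=> k; rewrite dyadicE !lebesgue_cube ?mulr_ge0 ?(ltW (pow_gt0 _))//.
    rewrite -EFinM -exprMn (_ : 2 * _ = (2 ^+ G)^-1)//.
    by field; rewrite expf_neq0.
have step2 : \bigcup_(k in dyadic_idx G @` F k0 G) cen k `<=` \bigcup_(gk in Y) big gk.
  move=> x [k [y Fy yk] cx].
  have Fx : F k0 G x by apply: F_dyadic Fy; rewrite yk (cen_dyadic _ _ cx).
  (* A half cube keeps a margin of 1/4 side. With [8 * K <= 2 ^+ N], the point [z] given by porosity
     is within 1/8 side of [x], hence in the same generation-[G] cube. *)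
  have [N KN] := ex_pow2_ge (8 * K).
  have [g [z [gN zO xz]]] := porous x (G + N)%N.
  have Kg : K / 2 ^+ g <= 1 / 8 / 2 ^+ G.
    rewrite ler_pdivrMr ?exprn_gt0// -(subnK gN) addnC !exprD.
    have GN : (2 : R) ^+ N * 2 ^+ (g - (G + N)) >= 8 * K.
      by rewrite -[leLHS]mulr1 ler_pM ?mulr_ge0// exprn_ege1// ler1n.
    have -> : 1 / 8 / 2 ^+ G * (2 ^+ G * 2 ^+ N * 2 ^+ (g - (G + N))) =
        (2 : R) ^+ N * 2 ^+ (g - (G + N)) / 8.
      by field; rewrite expf_neq0.
    by rewrite ler_pdivlMr// mulrC.
  have zk : dyadic G k z.
    rewrite dyadicE => i; have := xz i; rewrite ler_distl => /andP[x1 x2].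
    have /andP[] := cx i; move: Kg; have := pow_gt0 G.
    set h := (2 ^+ G)^-1 => h0 Kg c1 c2.
    by apply/andP; split; lra.
  (* Passing to the coarsest cube around [z] inside [O] can only enlarge the side, so [x] stays
     within [K] sides of [z]. *)
  have exg : exists g, `[< dyadic g (dyadic_idx g z) `<=` O >].
    by exists g; apply/asboolP.
  have [g1 /asboolP g1O g1min] := ex_minnP exg.
  have g1g : (g1 <= g)%N by apply: g1min; apply/asboolP.
  exists (g1, dyadic_idx g1 z) => /=.
    exists z; split=> //=.
      by apply: F_dyadic Fy; rewrite yk zk.
    by move=> g' g'g1 /asboolP/g1min; rewrite leqNgt g'g1.
  have Kg1 : K / 2 ^+ g <= K / 2 ^+ g1.
    by rewrite ler_wpM2l// lef_pV2 ?posrE ?exprn_gt0// ler_weXn2l// ler1n.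
  move=> i /=; have := xz i; rewrite ler_distl => /andP[x1 x2].
  have : dyadic g1 (dyadic_idx g1 z) z by [].
  rewrite dyadicE => /(_ i) /andP[].
  move: Kg1; have := pow_gt0 g1; set h := (2 ^+ g1)^-1 => h0 Kg1 z1 z2.
  by apply/andP; split; lra.
have step3 : (lam (\bigcup_(gk in Y) big gk) <=
    ((2 * K + 3) ^+ d)%:E * lam (\bigcup_(gk in Y) dy gk))%E.
  have K3 : 0 <= 2 * K + 3 by rewrite addr_ge0 ?mulr_ge0.
  apply: bigcup_measure_le => //.
  - by move=> gk; exact: measurable_cube.
  - move=> [g k] [g' k'] [z [/= zk _ kO zmin]] [z' [/= z'k' _ k'O z'min]].
    move=> [x []]; rewrite /dy /dyadic /= => xk xk'.
    (* Selected cubes that meet are nested; different generations would contradict the maximality of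
       the finer one. *)
    suff gg' : g = g' by rewrite -xk -xk' gg'.
    have [lt|lt|//] := ltngtP g g'; exfalso.
      apply: (z'min _ lt).
      by rewrite (dyadic_idx_le (ltnW lt) (etrans z'k' (esym xk'))) xk.
    apply: (zmin _ lt).
    by rewrite (dyadic_idx_le (ltnW lt) (etrans zk (esym xk))) xk'.
  - by rewrite exprn_ge0.
  - move=> [g k]; rewrite /big /dy dyadicE/= !lebesgue_cube ?mulr_ge0 ?(ltW (pow_gt0 _))//.
    by rewrite -EFinM -exprMn.
have step4 : \bigcup_(gk in Y) dy gk `<=` F k0 G `\` \bigcap_n F k0 n.
  move=> w [[g k] [z [/= zk Fz kO zmin]] wk]; rewrite /dy /dyadic/= in wk.
  split; last by move=> /(_ g I) [_]; rewrite wk.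
  (* A coarser selected cube would contain the generation-[G] cube around [z], which is not inside
     [O]. *)
  have Gg : (G <= g)%N.
    rewrite leqNgt; apply/negP => gG; case: Fz => _; apply=> y yz; apply: kO.
    by rewrite /dyadic/= -zk; apply: dyadic_idx_le yz; exact: ltnW.
  by apply: F_dyadic Fz; apply: (dyadic_idx_le Gg); rewrite zk wk.
have mF : measurable (\bigcap_n F k0 n) by exact: bigcapT_measurable.
apply: (le_trans step1); rewrite EFinM -muleA; apply: lee_wpmul2l.
  by rewrite lee_fin exprn_ge0.
apply: (@le_trans _ _ (lam (\bigcup_(gk in Y) big gk))).
  apply: le_measure; rewrite ?inE//; apply: measurable_bigcup_count.
    by move=> k _; exact: measurable_cube.
  by move=> k _; exact: measurable_cube.
apply: (le_trans step3); apply: lee_wpmul2l.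
  by rewrite lee_fin exprn_ge0// addr_ge0 ?mulr_ge0.
apply: le_measure; rewrite ?inE//; first exact: measurable_bigcup_count.
exact: measurableD.
Qed.

(** Inside a unit cube, continuity from above sends the measure of [F k0 n] minus the limit set to
    0. By [F_le], [M] times this measure bounds the measure of the limit set for every [n]. *)
Let bigcap_F_null k0 : lam (\bigcap_n F k0 n) = 0%E.
Proof.
have mF : measurable (\bigcap_n F k0 n) by exact: bigcapT_measurable.
have mFD n : measurable (F k0 n `\` \bigcap_n F k0 n) by exact: measurableD.
have F0fin : (lam (F k0 0%N `\` \bigcap_n F k0 n) < +oo)%E.
  apply: (@le_lt_trans _ _ (lam (dyadic 0 k0))).
    apply: le_measure; rewrite ?inE//; first exact: measurable_dyadic.
    by move=> x [[]].
  by rewrite dyadicE lebesgue_cube// ?ltry// invr_ge0 exprn_ge0.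
have := @nonincreasing_cvg_mu _ _ _ lam (fun n => F k0 n `\` \bigcap_n F k0 n)
  F0fin mFD (bigcapT_measurable mFD).
have -> : \bigcap_n (F k0 n `\` \bigcap_n F k0 n) = set0.
  rewrite -subset0 => x Fx; have [_] := Fx 0%N I; apply=> n _.
  by have [] := Fx n I.
rewrite measure0 => cvgF.
have /(cvgeZl (_ : M%:E \is a fin_num)) : lam \o (fun n => F k0 n `\` \bigcap_n F k0 n) @ \oo --> 0%E.
  apply: cvgF => m n mn; apply/subsetPset => x [Fx Fxoo]; split=> //.
  exact: F_sub Fx.
move=> /(_ isT); rewrite mule0 => cvgMF.
apply/eqP; rewrite -measure_le0.
apply: cvge_ge cvgMF; apply: nearW => n /=.
apply: le_trans (F_le k0 n); apply: le_measure; rewrite ?inE//.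
exact: bigcap_inf.
Qed.

(** A point outside [O] lies in its own dyadic cubes, so none of them is inside [O]: it survives in
    every [F k0 n] of its unit cube, and there are countably many unit cubes. *)
Lemma porous_null : measurable O -> lam (~` O) = 0%E.
Proof.
move=> mO; apply/eqP; rewrite -measure_le0.
apply: (@le_trans _ _ (lam (\bigcup_k0 \bigcap_n F k0 n))).
  apply: le_measure; rewrite ?inE.
  - exact: measurableC.
  - apply: measurable_bigcup_count => k _; exact: bigcapT_measurable.
  - move=> x Ox; exists (dyadic_idx 0 x) => // n _; split=> // xO.
    by apply: Ox; exact: xO.
rewrite bigcup_measure0// => k; exact: bigcapT_measurable.
Qed.

End Porous.

(** * Dirichlet's theorem on simultaneous approximation *)

(** Pigeonhole: the fractional parts of [M ^ d + 1] multiples of [x] fall into [M ^ d] boxes of side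
    1/M; the difference of two multiples in one box gives [q]. *)
Lemma simultaneous_approx (R : realType) (d M : nat) (x : d.-tuple R) :
  (0 < M)%N -> exists (q : nat) (p : d.-tuple int), [/\ (0 < q)%N, (q <= M ^ d)%N &
    forall i, `|q%:R * tnth x i - (tnth p i)%:~R| < M%:R^-1].
Proof.
case: M => // M _.
pose frac (t : R) := t - (Num.floor t)%:~R.
have frac_itv t : 0 <= frac t < 1.
  by have := floor_itv t; rewrite rmorphD/= /frac => /andP[t1 t2]; apply/andP; split; lra.
(* The box of the [j]-th multiple; [inord] never takes its default value, by [trunc_lt] below. *)
pose f (j : 'I_(M.+1 ^ d).+1) : {ffun 'I_d -> 'I_M.+1} :=
  [ffun i => inord (Num.truncn (M.+1%:R * frac (j%:R * tnth x i)))].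
have /injectivePn [j1 [j2 j12 fj12]] : ~~ injectiveb f.
  apply/negP => /injectiveP /leq_card.
  by rewrite card_ffun !card_ord ltnn.
wlog lt12 : j1 j2 j12 fj12 / (j1 < j2)%N.
  move=> wl; have [|j21|] := ltngtP j1 j2; first exact: wl.
    by apply: (wl j2 j1) => //; rewrite eq_sym.
  by move/val_inj => j12E; rewrite j12E eqxx in j12.
exists (j2 - j1)%N, [tuple Num.floor (j2%:R * tnth x i) - Num.floor (j1%:R * tnth x i) | i < d].
split; first by rewrite subn_gt0.
  by rewrite (leq_trans (leq_subr _ _))// -ltnS.
move=> i; rewrite tnth_mktuple.
have /(congr1 val) := congr1 (fun h : {ffun _} => h i) fj12; rewrite !ffunE /=.
set a := frac (j1%:R * tnth x i); set b := frac (j2%:R * tnth x i).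
have M0 : (0 : R) < M.+1%:R by rewrite ltr0n.
have trunc_lt (t : R) : 0 <= t < 1 -> (Num.truncn (M.+1%:R * t) < M.+1)%N.
  case/andP => t0 t1; rewrite -(ltr_nat R).
  apply: (@le_lt_trans _ _ (M.+1%:R * t)); last by rewrite gtr_pMr.
  by rewrite truncn_le mulr_ge0// ltW.
rewrite !inordK ?trunc_lt ?frac_itv// => ab.
have /andP[a0 _] := frac_itv (j1%:R * tnth x i).
have /andP[b0 _] := frac_itv (j2%:R * tnth x i).
have := truncn_itv (mulr_ge0 (ltW M0) a0); rewrite -/a ab => /andP[a1 a2].
have := truncn_itv (mulr_ge0 (ltW M0) b0); rewrite -/b => /andP[b1 b2].
have -> : (j2 - j1)%N%:R * tnth x i -
  (Num.floor (j2%:R * tnth x i) - Num.floor (j1%:R * tnth x i))%:~R = b - a.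
  by rewrite /b /a /frac natrB ?(ltnW lt12)// rmorphB/=; ring.
rewrite -(ltr_pM2l M0) divff ?gt_eqF// -[X in X * _]gtr0_norm// -normrM mulrBr.
rewrite ltr_distl; move: a1 a2 b1 b2; set m := Num.truncn _; rewrite -[m.+1%:R]natr1.
move=> a1 a2 b1 b2.
by apply/andP; split; lra.
Qed.

(** Dirichlet's theorem alone may return a small [q], whereas fine scales require large ones. If
    [n <= q], the bound on [q] by the [d]-th power of the precision suffices. *)
Lemma simultaneous_approx_ge (R : realType) (d n : nat) (x : d.-tuple R) :
  exists (q : nat) (p : d.-tuple int), [/\ (0 < q)%N, (n <= q)%N &
    forall i, q%:R * `|q%:R * tnth x i - (tnth p i)%:~R| ^+ d <= 1].
Proof.
have n0 : (0 < n.+1 ^ 3)%N by rewrite expn_gt0.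
have nR0 : (0 : R) < n.+1%:R by rewrite ltr0n.
have [q [p [q0 qM xp]]] := simultaneous_approx x n0.
have [nq|qn] := leqP n q.
  exists q, p; split=> // i.
  have qMR : q%:R <= (n.+1 ^ 3)%:R ^+ d :> R by rewrite -natrX ler_nat.
  have M0 : (0 : R) < (n.+1 ^ 3)%:R by rewrite ltr0n.
  apply: (@le_trans _ _ ((n.+1 ^ 3)%:R ^+ d * (n.+1 ^ 3)%:R^-1 ^+ d)).
    by rewrite ler_pM ?exprn_ge0// lerXn2r ?nnegrE// ltW.
  by rewrite -exprMn divff ?gt_eqF// expr1n.
(* A denominator q < n is replaced by (n+1)q: the error is multiplied by n+1,
   which the precision (n+1)^-3 leaves room for. *)
exists (n.+1 * q)%N, [tuple n.+1%:Z * tnth p i | i < d]; split=> [||i].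
- by rewrite muln_gt0.
- by rewrite (leq_trans (leqnSn n))// leq_pmulr.
rewrite tnth_mktuple natrM rmorphM/= -[_%:~R in X in _ - X * _]pmulrn -!mulrA -mulrBr normrM gtr0_norm// mulrA.
set t := `|_ - _|.
have nn : n.+1%:R * t <= n.+1%:R ^- 2.
  have := xp i; rewrite -/t natrX => /ltW.
  rewrite -(ler_pM2l nR0) => /le_trans; apply.
  by rewrite exprS invfM mulrA divff ?gt_eqF// mul1r.
have n1 : n.+1%:R ^- 2 <= 1 :> R by rewrite invf_le1 ?exprn_gt0// exprn_ege1// ler1n.
have t0 : 0 <= n.+1%:R * t by apply: mulr_ge0; [exact: ltW|exact: normr_ge0].
(* As [q < n], the first factor is at most [n.+1 ^ 2]. A [d]-th power of a number in [0, 1] is at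
   most that number, the index [i] showing that [d] is positive. *)
apply: (@le_trans _ _ (n.+1%:R ^+ 2 * n.+1%:R ^- 2)).
  apply: ler_pM; [by rewrite mulr_ge0|exact: exprn_ge0| |].
    by rewrite expr2 ler_wpM2l// ler_nat ltnW// leqW.
  apply: le_trans (nn); rewrite -[leRHS]expr1 ler_wiXn2l//.
    exact: le_trans nn n1.
  exact: leq_ltn_trans (ltn_ord i).
by rewrite divff// expf_neq0// gt_eqF.
Qed.

(** * Points with an approximation near a given target *)

Definition hit (R : realType) (d : nat) (eta : R) (y : d.-tuple R) (e : R)
    : set (d.-tuple R) :=
  [set a | exists v, NA eta a v /\ forall i, `|tnth v i - tnth y i| < e].

(** A countable union, over [q] and [p], of products of measurable subsets of the line. *)
Lemma measurable_hit (R : realType) (d : nat) (eta : R) (y : d.-tuple R) (e : R) :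
  measurable (hit eta y e).
Proof.
pose c (q : int) : R := `|q|%:~R `^ eta.
pose f (qp : int * d.-tuple int) i (t : R) :=
  `|c qp.1 * (qp.1%:~R * t - (tnth qp.2 i)%:~R) - tnth y i|.
have -> : hit eta y e = \bigcup_(qp in [set qp : int * d.-tuple int | qp.1 != 0])
    [set a | forall i, (f qp i @^-1` `]-oo, e[%classic) (tnth a i)].
  apply/seteqP; split=> [a [v [[q [p [q0 vE]]] ve]]|a [[q p] /= q0 ae]].
    by exists (q, p) => //= i; rewrite in_itv/= /f -vE.
  exists [tuple c q * (q%:~R * tnth a i - (tnth p i)%:~R) | i < d]; split.
    by exists q, p; split=> // i; rewrite tnth_mktuple.
  by move=> i; have := ae i; rewrite in_itv/= tnth_mktuple.
apply: measurable_bigcup_count => qp _.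
apply: (measurable_box (I := fun i => f qp i @^-1` _)) => i.
have mf : measurable_fun setT (f qp i).
  apply: measurableT_comp => //; apply: measurable_funB => //.
  by apply: measurable_funM => //; apply: measurable_funB.
by rewrite -[X in measurable X]setTI; exact: mf.
Qed.

Lemma hit_setT (R : realType) (d : nat) (eta : R) (y : d.-tuple R) (e : R) :
  eta < 0 -> 0 < e -> hit eta y e = setT.
Proof.
move=> eta0 e0; apply/seteqP; split=> // a _.
have Neta0 : 0 < - eta by rewrite oppr_gt0.
pose T : R := e^-1 `^ (- eta)^-1.
pose q := Num.bound T.
have T0 : 0 <= T by exact: powR_ge0.
have Tq : T < q%:R := archi_boundP T0.
have q0 : (0 : R) < q%:R by exact: le_lt_trans Tq.
pose c : R := q%:R `^ eta.
have c0 : 0 < c by exact: powR_gt0.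
have ce : c < e.
  have : T `^ (- eta) < q%:R `^ (- eta) by rewrite gt0_ltr_powR ?nnegrE// ltW.
  rewrite -powRrM mulVf ?gt_eqF// powRr1 ?invr_ge0 ?(ltW e0)//.
  by rewrite powRN ltf_pV2.
(* Rounding down costs less than 1, hence less than [c < e] after rescaling. *)
exists [tuple c * (q%:R * tnth a i - (Num.floor (q%:R * tnth a i - tnth y i / c))%:~R) | i < d].
split.
  exists (Posz q), [tuple Num.floor (q%:R * tnth a i - tnth y i / c) | i < d].
  split; first by move: q0; rewrite ltr0n lt0n.
  by move=> i; rewrite !tnth_mktuple.
move=> i; rewrite tnth_mktuple.
set s := _ - _ / c; have := floor_itv s; rewrite rmorphD/=.
set m := (Num.floor s)%:~R => /andP[ms sm].
have -> : c * (q%:R * tnth a i - m) - tnth y i = c * (s - m).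
  by rewrite /s; field; rewrite gt_eqF.
rewrite ger0_norm ?mulr_ge0 ?subr_ge0 ?(ltW c0)//; apply: le_lt_trans ce.
by rewrite ler_piMr ?(ltW c0)//; lra.
Qed.

(** Take the least [g] with side below [rho]. The bound on [rho] forces [g0 < g], so [g] has a
    predecessor, whose failure gives the upper bound. *)
Lemma ex_dyadic_scale (R : realType) (rho : R) (g0 : nat) :
  0 < rho -> rho < (2 ^+ g0)^-1 ->
  exists g, [/\ (g0 <= g)%N, (2 ^+ g)^-1 < rho & rho <= 2 / 2 ^+ g].
Proof.
move=> rho0 rhog0.
have exg : exists g, (2 ^+ g)^-1 < rho.
  have [g rhog] := ex_pow2_ge (2 / rho); exists g.
  rewrite -[ltRHS]invrK ltf_pV2 ?posrE ?exprn_gt0 ?invr_gt0//.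
  by apply: lt_le_trans rhog; rewrite ltr_pMl ?invr_gt0// ltr1n.
have [g grho gmin] := ex_minnP exg.
have g0g : (g0 < g)%N.
  rewrite ltnNge; apply/negP => gg0.
  have : (2 ^+ g)^-1 < (2 ^+ g0)^-1 :> R by exact: lt_trans rhog0.
  by rewrite ltf_pV2 ?posrE ?exprn_gt0// ltNge ler_weXn2l// ler1n.
exists g; split=> //; first exact: ltnW.
case: g {grho} g0g gmin => // g _ gmin.
rewrite exprS invfM mulrA divff// mul1r leNgt; apply/negP => /gmin.
by rewrite ltnn.
Qed.

Lemma hit_null (R : realType) (d : nat) (eta : R)
    (lam : {measure set (d.-tuple R) -> \bar R}) (y : d.-tuple R) (e : R) :
  is_lebesgue_measure lam -> (0 < d)%N -> eta <= d%:R^-1 -> 0 < e ->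
  lam (~` hit eta y e) = 0%E.
Proof.
move=> lebl d0 etad e0.
have [eta0|eta0] := ltP eta 0; first by rewrite hit_setT// setCT measure0.
pose Y : R := \sum_i `|tnth y i|.
have yY i : `|tnth y i| <= Y by rewrite /Y (bigD1 i)//= lerDl sumr_ge0.
have Y0 : 0 <= Y by exact: sumr_ge0.
have YE0 : 0 <= (1 + Y) / e by rewrite divr_ge0 ?(ltW e0)// addr_ge0.
(* [(1 + Y) / e] bounds the distance from [x] to [z] in units of [rho]; the 2 is lost in rounding
   [rho] to a dyadic side. *)
apply: (@porous_null _ _ _ lebl _ (2 * ((1 + Y) / e))); last exact: measurable_hit.
  by rewrite mulr_ge0.
move=> x g0.
(* Chosen so that [q >= n] puts [rho] below the side of generation [g0], as [c >= 1] for nonnegative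
   [eta]. *)
pose n := Num.bound (e * 2 ^+ g0).
have ne : e * 2 ^+ g0 < n%:R by apply: archi_boundP; rewrite mulr_ge0 ?exprn_ge0// ltW.
have [q [p [q0 nq xp]]] := simultaneous_approx_ge n x.
pose Q : R := q%:R; pose c := Q `^ eta.
have Q1 : 1 <= Q by rewrite ler1n.
have Q0 : 0 < Q by exact: lt_le_trans Q1.
have c1 : 1 <= c by rewrite -(powRr0 Q) ler_powR.
have c0 : 0 < c by exact: lt_le_trans c1.
have cQ0 : 0 < c * Q by exact: mulr_gt0.
pose rho := e / (c * Q).
have rho0 : 0 < rho by exact: divr_gt0.
have rhog0 : rho < (2 ^+ g0)^-1.
  rewrite ltr_pdivrMr// -ltr_pdivrMl ?invr_gt0 ?exprn_gt0// invrK mulrC.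
  apply: (lt_le_trans ne); apply: (@le_trans _ _ Q); first by rewrite ler_nat.
  by rewrite ler_peMl// ltW.
have [g [g0g grho rhog]] := ex_dyadic_scale rho0 rhog0.
(* The point whose normalized approximation by [q] and [p] is exactly [y]. *)
pose z := [tuple ((tnth p i)%:~R + tnth y i / c) / Q | i < d].
have zE i w : c * (Q * w - (tnth p i)%:~R) - tnth y i = c * Q * (w - tnth z i).
  by rewrite tnth_mktuple; field; rewrite !gt_eqF.
exists g, z; split=> // [w wz|i].
  exists [tuple c * (Q * tnth w i - (tnth p i)%:~R) | i < d]; split.
    exists (Posz q), p; split; first by rewrite -lt0n.
    by move=> i; rewrite tnth_mktuple.
  move=> i; rewrite tnth_mktuple zE normrM gtr0_norm// -ltr_pdivlMl// mulrC.
  exact: lt_trans (dyadic_dist wz i) grho.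
(* Here [eta <= d%:R^-1] enters: it bounds [c] by the [d]-th root of [Q], and the [d]-th power of
   the resulting inequality is Dirichlet's bound. *)
have cx : c * `|Q * tnth x i - (tnth p i)%:~R| <= 1.
  have d0R : (d%:R : R) != 0 by rewrite pnatr_eq0 -lt0n.
  apply: (@le_trans _ _ (Q `^ d%:R^-1 * `|Q * tnth x i - (tnth p i)%:~R|)).
    by rewrite ler_wpM2r// ler_powR.
  rewrite -(@expr_le1 _ d)// ?mulr_ge0 ?powR_ge0// exprMn.
  by rewrite -powR_mulrn ?powR_ge0// -powRrM mulVf// powRr1 ?(ltW Q0).
have : c * Q * `|tnth x i - tnth z i| <= 1 + Y.
  rewrite -[in X in X * _](gtr0_norm cQ0) -normrM -zE.
  apply: (le_trans (ler_normB _ _)); apply: lerD => //.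
  by rewrite normrM gtr0_norm.
rewrite -ler_pdivlMl// => /le_trans; apply.
have -> : (c * Q)^-1 * (1 + Y) = (1 + Y) / e * rho.
  by rewrite /rho; field; rewrite !gt_eqF.
rewrite [leRHS](_ : _ = (1 + Y) / e * (2 / 2 ^+ g)); last by ring.
exact: ler_wpM2l.
Qed.

(** * Countable intersection and conclusion *)

Lemma D_bigcap_hit (R : realType) (d : nat) (eta : R) : (0 < d)%N ->
  D eta = \bigcap_(ym : d.-tuple rat * nat)
            hit eta [tuple ratr (tnth ym.1 i) | i < d] ym.2.+1%:R^-1.
Proof.
move=> d0; apply/seteqP; split=> a.
  move=> Da [y m] _ /=.
  have : Acc eta a [tuple ratr (tnth y i) | i < d] by rewrite Da.
  have m0 : (0 : R) < m.+1%:R^-1 by rewrite invr_gt0.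
  by move=> /(_ _ m0) [v [av [_ vy]]]; exists v.
move=> ha; apply/seteqP; split=> // x _ e e0.
(* An accumulation point must be approached by points other than itself. The rational target is
   therefore shifted off [x], so that approximations within [e / 4] of it exceed [x] in every
   coordinate. *)
have ex_y i : exists y : rat, ratr y \in `]tnth x i + e / 4, tnth x i + e / 2[.
  by apply: rat_in_itvoo; lra.
pose y i := xchoose (ex_y i).
pose m := Num.bound (4 / e).
have me : m.+1%:R^-1 <= e / 4.
  rewrite -[leRHS]invrK invf_div lef_pV2 ?posrE ?divr_gt0//.
  apply: ltW; apply: (lt_trans (archi_boundP (_ : 0 <= 4 / e))).
    by rewrite divr_ge0 ?ltW.
  by rewrite ltr_nat.
have [v [av vy]] := ha ([tuple y i | i < d], m) I.
have xv i : 0 < tnth v i - tnth x i < e.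
  have := vy i; rewrite /= !tnth_mktuple ltr_distl => /andP[v1 v2].
  have := xchooseP (ex_y i); rewrite -/(y i) in_itv/= => /andP[y1 y2].
  move: me v1 v2 y1 y2; set u := ratr _; set w := _^-1 => me v1 v2 y1 y2.
  by apply/andP; split; move: e0; lra.
exists v; split=> //; split.
  by move=> vx; have := xv (Ordinal d0); rewrite vx subrr ltxx.
by move=> i; have /andP[v1 v2] := xv i; rewrite gtr0_norm.
Qed.

Lemma lebesgue_setT (R : realType) (d : nat)
    (lam : {measure set (d.-tuple R) -> \bar R}) :
  is_lebesgue_measure lam -> (0 < d)%N -> lam setT = +oo%E.
Proof.
move=> lebl d0; apply: eq_infty => r.
pose n := Num.bound `|r|.
have rn : r <= n%:R by exact: le_trans (ler_norm r) (ltW (archi_boundP (normr_ge0 r))).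
apply: (@le_trans _ _ (lam (cube (fun=> 0) n.+1%:R))); last first.
  by apply: le_measure; rewrite ?inE//; exact: measurable_cube.
rewrite lebesgue_cube// lee_fin; apply: (le_trans rn).
apply: (@le_trans _ _ n.+1%:R); first by rewrite ler_nat.
by rewrite -[leLHS]expr1 ler_weXn2l// ler1n.
Qed.

Theorem theorem1 (R : realType) (d : nat) (eta : R)
  (lam : {measure set (d.-tuple R) -> \bar R}) :
  (0 < d)%N -> eta <= d%:R^-1 -> is_lebesgue_measure lam ->
  lam (@D R d eta) = +oo%E /\ lam (~` @D R d eta) = 0%E.
Proof.
move=> d0 etad lebl.
have DcE := congr1 setC (D_bigcap_hit eta d0); rewrite setC_bigcap in DcE.
have mDc : measurable (~` @D R d eta).
  rewrite DcE; apply: measurable_bigcup_count => ym _.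
  by apply: measurableC; exact: measurable_hit.
have mD : measurable (@D R d eta) by rewrite -[D eta]setCK; exact: measurableC.
have Dc0 : lam (~` @D R d eta) = 0%E.
  rewrite DcE bigcup_measure0// => ym.
    by apply: measurableC; exact: measurable_hit.
  by apply: hit_null => //; rewrite invr_gt0.
(* Subadditivity bounds the infinite measure of the whole space by that of [D eta] plus 0. *)
split=> //; apply/eqP; rewrite -leye_eq -(lebesgue_setT lebl d0).
rewrite -(setUv (D eta)) -[leRHS]adde0 -Dc0; exact: measureU2.
Qed.
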